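(* Let $d=1$, $\alpha\in(0,1)$, $\gamma>0$, and let $B\subset\mathbb R$ be a bounded open domain containing the origin with $0<\inf_{x\in\partial B}|x|\le\sup_{x\in\partial B}|x|<\infty$. Let $\psi_\gamma(p)=(1/\alpha-p)^{-\gamma}$ for $p\in[1,1/\alpha)$. Then there exist a function $f_0\in G(\psi_\gamma)$ and a constant $C_2>0$ such that $u=I^{(B)}_\alpha f_0$ satisfies $$|u|_r\ge C_2\,r^{1+\gamma-\alpha}\qquad\text{for all } r\ge1.$$
   Context: The truncated Riesz operator on $\mathbb R$ is $I^{(B)}_\alpha f(x)=\int_B\frac{f(x-y)\,dy}{|y|^{1-\alpha}}$. $|f|_p=\left(\int_{\mathbb R}|f|^p\,dx\right)^{1/p}$. $G(\psi_\gamma)$ is the space of measurable $f:\mathbb R\to\mathbb R$ with $\|f\|G(\psi_\gamma)=\sup_{p\in[1,1/\alpha)}|f|_p/\psi_\gamma(p)<\infty$. *)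

(* Defs.v *)
(* MathComp-Analysis *)
From HB Require Import structures.
From mathcomp Require Export all_boot all_order all_algebra.
From mathcomp Require Export all_classical all_reals all_analysis.

Set Implicit Arguments.
Unset Strict Implicit.
Unset Printing Implicit Defensive.

Export Order.TTheory GRing.Theory Num.Theory.
Export numFieldNormedType.Exports.

Local Open Scope classical_set_scope.
Local Open Scope ring_scope.

Definition boundary (T : topologicalType) (A : set T) : set T :=
  closure A `\` interior A.

(* "Domain" means a connected open set.  The infimum and supremum are taken in
   the extended reals, since in R [inf] and [sup] are 0 when undefined. *)
Definition origin_domain (R : realType) (B : set R) : Prop :=
  [/\ open B, connected B, bounded_set B & B 0] /\
  [/\ (0 < ereal_inf [set `|x|%:E | x in boundary B])%E,
      (ereal_inf [set `|x|%:E | x in boundary B] <=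
         ereal_sup [set `|x|%:E | x in boundary B])%E &
      (ereal_sup [set `|x|%:E | x in boundary B] < +oo)%E].

(* Extended-real valued: the integral need not converge at every [x].  The
   value of the kernel at [y = 0], a null set, is immaterial. *)
Definition truncated_riesz (R : realType) (B : set R) (alpha : R)
    (f : R -> R) (x : R) : \bar R :=
  (\int[lebesgue_measure]_(y in B) (f (x - y) / `|y| `^ (1 - alpha))%:E)%E.

Definition Lpnorm (R : realType) (p : R) (u : R -> \bar R) : \bar R :=
  ('N[lebesgue_measure]_(p%:E)[u])%E.

Definition psi (R : realType) (alpha gamma p : R) : R :=
  (alpha^-1 - p) `^ (- gamma).

Definition GLnorm (R : realType) (alpha : R) (w : R -> R) (f : R -> R) : \bar R :=
  ereal_sup [set (Lpnorm p (EFin \o f) / (w p)%:E)%E | p in `[1, alpha^-1[].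

Definition GLspace (R : realType) (alpha : R) (w : R -> R) : set (R -> R) :=
  [set f | measurable_fun setT f /\ (GLnorm alpha w f < +oo)%E].

(* Main.v *)
Require Import Defs.
From mathcomp Require Import measurable_realfun ring lra.

(** Fix 0 < delta <= 1 with ]-delta, delta[ included in B, put
    L(t) = ln (delta / t), and take f0(t) = t^(-alpha) L(t)^(gamma - alpha)
    on ]0, delta[ and 0 elsewhere.

    With s = 1 - alpha p and m = (gamma - alpha) p + 1 = gamma p + s, the p-th
    power of |f0|_p is the integral of t^(s-1) L^(m-1), a truncated Gamma
    integral, which is O(s^(-m)) uniformly in p since m >= gamma; its p-th root
    is O(s^(-gamma) s^(-s/p)), and s^(-s) <= e.

    For 0 < x < a = delta e^(-r), put b = delta e^(-r/2): restricting the Riesz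
    integral to x - y in [a, b], where |y| <= x - y, bounds u(x) below by the
    integral of L(t)^(gamma - alpha) / t over [a, b], which is a multiple of
    r^(1 + gamma - alpha). The interval ]0, a[ has measure delta e^(-r), whose
    r-th root stays away from 0. *)

Local Open Scope classical_set_scope.
Local Open Scope ring_scope.

Section integrals.
Set Implicit Arguments.
Unset Strict Implicit.
Context {R : realType}.
Notation mu := (@lebesgue_measure R).

(** * Integration on intervals and elementary inequalities *)

Lemma is_derive_continuous (F : R -> R) (x v : R) :
  is_derive x 1 F v -> {for x, continuous F}.
Proof. by move=> dF; apply/differentiable_continuous/derivable1_diffP. Qed.

Lemma is_derive_FTC2 (F f : R -> R) (a b : R) : a < b ->
  {in `[a, b], forall x : R, is_derive x 1 F (f x)} ->
  {in `[a, b], forall x, {for x, continuous f}} ->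
  (\int[mu]_(x in `[a, b]) (f x)%:E = (F b - F a)%:E)%E.
Proof.
move=> ab dF cf; rewrite EFinB; apply: continuous_FTC2 => //.
- by apply: continuous_in_subspaceT => x; rewrite inE => /cf.
- have cF x : x \in `[a, b] -> {for x, continuous F}.
    by move=> /dF; exact: is_derive_continuous.
  split.
  + by move=> x /subset_itv_oo_cc /dF dFx; exact: ex_derive.
  + by apply: cvg_at_right_filter; apply: cF; rewrite bound_itvE ltW.
  + by apply: cvg_at_left_filter; apply: cF; rewrite bound_itvE ltW.
- by move=> x /subset_itv_oo_cc /dF dFx; rewrite derive1E derive_val.
Qed.

(** The open interval is exhausted by compact ones, the fundamental theorem gives each integral as
    an increment of [F], and monotone convergence passes to the limit. Bounding increments avoids
    computing limits of [F] at the endpoints, where [f] may blow up. *)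
Lemma ge0_integral_oo_le (F f : R -> R) (a b K : R) : a < b ->
  {in `]a, b[, forall x, 0 <= f x} ->
  {in `]a, b[, forall x : R, is_derive x 1 F (f x)} ->
  {in `]a, b[, forall x, {for x, continuous f}} ->
  {in `]a, b[ &, forall x y, F y - F x <= K} ->
  (\int[mu]_(x in `]a, b[) (f x)%:E <= K%:E)%E.
Proof.
move=> ab f0 dF cf FK.
(* The shift to [n + 3] makes [e n < (b - a) / 2], so every [[a + e n, b - e n]] is
   nondegenerate. *)
pose e n := (b - a) / n.+3%:R.
have e_gt0 n : 0 < e n by rewrite divr_gt0// ?subr_gt0.
have e_lt n : e n < (b - a) / 2.
  by rewrite /e ltr_pM2l ?subr_gt0// ltf_pV2 ?posrE// ltr_nat.
pose D n : set R := [set` `[a + e n, b - e n]].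
have sub n : D n `<=` `]a, b[.
  rewrite /D => x /=; rewrite !in_itv/= => /andP[h1 h2].
  by have := e_gt0 n => en; apply/andP; split; lra.
have -> : [set` `]a, b[] = \bigcup_n D n.
  apply/seteqP; split => [x|x [n _]]; last exact: sub.
  rewrite /= in_itv/= => /andP[ax xb].
  pose m := Num.min (x - a) (b - x).
  have m0 : 0 < m by rewrite lt_min !subr_gt0 ax xb.
  have [n nm] : exists n : nat, (b - a) / m < n%:R.
    by exists (Num.bound ((b - a) / m)); rewrite archi_boundP// divr_ge0 ?ltW ?subr_gt0.
  have em : e n <= m.
    rewrite /e ler_pdivrMr// mulrC -ler_pdivrMr//.
    by rewrite (le_trans (ltW nm))// ler_nat -addn3 leq_addr.
  move: em; rewrite /m le_min => /andP[h1 h2].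
  by exists n => //; rewrite /D /= in_itv/=; apply/andP; split; lra.
have mf : measurable_fun `]a, b[ f.
  apply: open_continuous_measurable_fun; first exact: interval_open.
  by move=> x; rewrite inE => /cf.
have cv : (\int[mu]_(x in D n) (f x)%:E @[n --> \oo] -->
    \int[mu]_(x in \bigcup_n D n) (f x)%:E)%E.
  apply: ge0_nondecreasing_set_cvg_integral => //.
  - move=> m n mn; apply/subsetPset => x /=; rewrite /D /= !in_itv/= => /andP[h1 h2].
    have : e n <= e m.
      by rewrite /e ler_pM2l ?subr_gt0// lef_pV2 ?posrE// ler_nat !ltnS.
    by move=> h; apply/andP; split; lra.
  - by move=> i; exact: measurable_itv.
  - by move=> i; apply/measurable_EFinP; apply: measurable_funS mf.
  - by move=> i x /sub xi; rewrite lee_fin; exact: f0.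
rewrite -(cvg_lim _ cv)//; apply: lime_le; first by apply/cvg_ex; eexists; exact: cv.
apply: nearW => n.
rewrite (@is_derive_FTC2 F); last 3 first.
- by have := e_lt n; lra.
- by move=> x /sub; exact: dF.
- by move=> x /sub; exact: cf.
rewrite lee_fin; apply: FK; apply: (sub n); rewrite /D /= in_itv/= lexx ?andbT /=;
  have := e_lt n; lra.
Qed.

(** The integral of a nonnegative function is the supremum over the simple functions below it, and
    [c] times the indicator of [A] is one of them. In this form the bound applies to the Riesz
    potential without a proof that it is measurable. *)
Lemma le_cst_integral d (T : measurableType d) (nu : {measure set T -> \bar R})
    (A : set T) (c : R) (f : T -> \bar R) :
  measurable A -> 0 <= c -> (forall x, 0 <= f x)%E ->
  (forall x, A x -> c%:E <= f x)%E ->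
  (c%:E * nu A <= \int[nu]_x f x)%E.
Proof.
move=> mA c0 f0 cf; rewrite ge0_integralTE//.
apply: ereal_sup_ubound; exists (scale_nnsfun (indic_nnsfun R mA) c0) => /=.
  move=> x; rewrite mindicE; case: (boolP (x \in A)) => [|_].
    by rewrite inE mulr1; exact: cf.
  by rewrite mulr0.
by rewrite sintegralrM sintegral_indic.
Qed.

(** Since [1 + w <= M (1 + w / M) <= M exp (w / M)], it suffices to raise to the power [M]. The
    constant depends on [a] only through its upper bound [M]. *)
Lemma powR1D_le_expR (M a w : R) : 0 <= w -> 1 <= M -> a <= M ->
  (1 + w) `^ a <= M `^ M * expR w.
Proof.
move=> w0 M1 aM.
have M0 : 0 < M by exact: lt_le_trans M1.
have w1 : 1 <= 1 + w by rewrite lerDl.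
apply: (le_trans (ler_powR w1 aM)).
have -> : expR w = expR (w / M) `^ M.
  by rewrite /powR gt_eqF ?expR_gt0// expRK mulrC divfK// gt_eqF.
rewrite -powRM ?expR_ge0 ?(ltW M0)//; apply: (ge0_ler_powR (ltW M0)); rewrite ?nnegrE.
- by rewrite addr_ge0.
- by rewrite mulr_ge0 ?expR_ge0 ?ltW.
apply: (@le_trans _ _ (M * (1 + w / M))).
  by rewrite mulrDr mulr1 mulrC divfK ?gt_eqF// lerD2r.
by rewrite ler_pM2l// expR_ge1Dx.
Qed.

(** * Derivatives of powers and logarithms *)

Lemma continuous_powRl (a x : R) : 0 < x -> {for x, continuous (@powR R ^~ a)}.
Proof. by move=> x0; apply: is_derive_continuous (is_derive1_powR a x0). Qed.

Definition log_ratio (delta t : R) : R := ln delta - ln t.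

Lemma log_ratio_gt0 (delta t : R) : t \in `]0, delta[ -> 0 < log_ratio delta t.
Proof.
rewrite in_itv/= => /andP[t0 td]; rewrite subr_gt0 ltr_ln// posrE//.
exact: lt_trans td.
Qed.

Lemma is_derive_log_ratio (delta t : R) : 0 < t ->
  is_derive t 1 (log_ratio delta) (- t^-1).
Proof.
move=> t0; rewrite /log_ratio; have h := is_derive1_ln t0.
by apply: is_derive_eq; rewrite add0r mul1r.
Qed.

Lemma continuous_log_ratio (delta t : R) : 0 < t ->
  {for t, continuous (log_ratio delta)}.
Proof. by move=> t0; exact: is_derive_continuous (is_derive_log_ratio delta t0). Qed.

(** With [v = w / (1 + s w)], whose derivative is [(1 + s w)^(-2)], this is the chain rule for
    [- v^m / m]. For [s > 0], [v] stays below [1 / s], so this explicit primitive is bounded and can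
    stand in for the incomplete Gamma function. *)
Lemma is_derive_powR_div (s m w : R) : 0 <= s -> 0 < w -> 0 < m ->
  is_derive w 1 (fun w : R => - (w `^ m * (1 + s * w) `^ (- m) / m))
    (- (w `^ (m - 1) * (1 + s * w) `^ (- (m + 1)))).
Proof.
move=> s0 w0 m0.
have z0 : 0 < 1 + s * w by rewrite ltr_pwDl// mulr_ge0// ltW.
have h1 := is_derive1_powR m w0.
have h2 : is_derive w (1 : R) (fun w : R => 1 + s * w) s.
  by apply: is_derive_eq; rewrite add0r mul1r /GRing.scale/= mulr1.
have h3 := @is_derive1_comp _ (@powR R ^~ (- m)) (fun w : R => 1 + s * w) w _ _
  (is_derive1_powR (- m) z0) h2.
have h4 := is_deriveM h1 h3.
have h5 := is_deriveM h4 (is_derive_cst m^-1 w 1).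
have h6 := is_deriveN h5.
apply: (is_derive_eq h6).
rewrite /= /GRing.scale/= mulr0 add0r.
have -> : w `^ m = w * w `^ (m - 1) by rewrite mulr_powRB1// ltW.
rewrite -opprD.
have -> : (1 + s * w) `^ (- m) = (1 + s * w) * (1 + s * w) `^ (- (m + 1)).
  rewrite -{2}(powRr1 (ltW z0)) -powRD; last by apply/implyP => _; rewrite gt_eqF.
  by congr (_ `^ _); ring.
by field; rewrite gt_eqF.
Qed.

(** * The truncated Gamma integral *)

Section log_power_integral.
Variables (delta s m : R).
Hypotheses (delta0 : 0 < delta) (delta1 : delta <= 1) (s0 : 0 < s) (m0 : 0 < m).

Let g (t : R) :=
  log_ratio delta t `^ (m - 1) * (1 + s * log_ratio delta t) `^ (- (m + 1)) / t.

Let lin_gt0 t : t \in `]0, delta[ -> 0 < 1 + s * log_ratio delta t.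
Proof. by move=> /log_ratio_gt0 l0; rewrite ltr_pwDl// mulr_ge0// ltW. Qed.

Let g_ge0 : {in `]0, delta[, forall t, 0 <= g t}.
Proof.
move=> t; rewrite in_itv/= => /andP[t0 _].
by rewrite divr_ge0 ?mulr_ge0 ?powR_ge0 ?ltW.
Qed.

Let cg : {in `]0, delta[, forall t : R, {for t, continuous g}}.
Proof.
move=> t tD; have l0 := log_ratio_gt0 tD; have z0 := lin_gt0 tD.
move: tD; rewrite in_itv/= => /andP[t0 _].
have cl := continuous_log_ratio (delta := delta) t0.
apply: continuousM; last by apply: continuousV; [rewrite gt_eqF|exact: cvg_id].
apply: continuousM.
  by apply: (@continuous_comp _ _ _ (log_ratio delta) (@powR R ^~ (m - 1))) => //;
    exact: continuous_powRl.
apply: (@continuous_comp _ _ _ (fun t => 1 + s * log_ratio delta t) (@powR R ^~ (- (m + 1)))).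
  by apply: cvgD; [exact: cvg_cst|apply: cvgM; [exact: cvg_cst|exact: cl]].
exact: continuous_powRl.
Qed.

(* [g] is the derivative of [- (L / (1 + s L)) ^ m / m], which takes values in
   [[- s ^ (- m) / m, 0]]; the factor [M ^ M] absorbs
   [(1 + s L) ^ (m + 1) exp (- s L)]. *)
Lemma integral_log_power_le (M : R) : m + 1 <= M ->
  (\int[mu]_(t in `]0%R, delta[) (t `^ (s - 1) * log_ratio delta t `^ (m - 1))%:E
    <= (M `^ M * (s `^ (- m) / m))%:E)%E.
Proof.
move=> mM.
have M1 : 1 <= M by apply: le_trans mM; rewrite lerDr ltW.
pose H (w : R) := - (w `^ m * (1 + s * w) `^ (- m) / m).
have gK : (\int[mu]_(t in `]0%R, delta[) (g t)%:E <= (s `^ (- m) / m)%:E)%E.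
  apply: (@ge0_integral_oo_le (H \o log_ratio delta)) => //.
  - move=> t tD; have l0 := log_ratio_gt0 tD.
    move: tD; rewrite in_itv/= => /andP[t0 _].
    apply: (is_derive_eq (is_derive1_comp (is_derive_powR_div (ltW s0) l0 m0)
      (is_derive_log_ratio delta t0))).
    by rewrite mulrNN.
  - move=> x y xD yD.
    rewrite /H /= opprK addrC lerBlDr; apply: ler_wpDr.
      by rewrite divr_ge0 ?mulr_ge0 ?powR_ge0 ?ltW.
    have l0 := log_ratio_gt0 xD; have z0 := lin_gt0 xD.
    rewrite ler_pM2r ?invr_gt0// !powRN -ler_pdivlMr ?invr_gt0 ?powR_gt0// invrK.
    rewrite mulrC ler_pdivlMr ?powR_gt0//.
    rewrite -powRM ?(ltW s0) ?(ltW l0)//.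
    apply: (ge0_ler_powR (ltW m0)); rewrite ?nnegrE.
    + by rewrite mulr_ge0// ltW.
    + exact: ltW.
    + by rewrite mulrC lerDr.
have mg : measurable_fun `]0, delta[ g.
  apply: open_continuous_measurable_fun; first exact: interval_open.
  by move=> x; rewrite inE => /cg.
have mul : measurable_fun `]0, delta[ (fun t => M `^ M * g t).
  by apply: measurable_funM.
apply: (@le_trans _ _ (\int[mu]_(t in `]0%R, delta[) (M `^ M * g t)%:E)%E).
  apply: ge0_le_integral => //=.
  - by move=> t _; rewrite lee_fin mulr_ge0 ?powR_ge0.
  - apply/measurable_EFinP/measurable_funM.
      by apply: measurable_funTS; exact: measurable_powR.
    apply: (measurableT_comp (measurable_powR _)).
    by apply: measurable_funTS; apply: measurable_funB => //; exact: measurable_ln.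
  - exact/measurable_EFinP.
  - move=> t tD; rewrite lee_fin.
    have l0 := log_ratio_gt0 tD; have z0 := lin_gt0 tD.
    move: (tD); rewrite in_itv/= => /andP[t0 _].
    have -> : t `^ (s - 1) = t `^ s / t.
      rewrite powRB ?powRr1 ?ltW//; by apply/implyP => _; rewrite gt_eqF.
    rewrite /g mulrAC [leRHS]mulrA ler_pM2r ?invr_gt0//.
    rewrite mulrC mulrCA ler_pM2l ?powR_gt0//.
    rewrite powRN ler_pdivlMr ?powR_gt0//.
    have := powR1D_le_expR (mulr_ge0 (ltW s0) (ltW l0)) M1 mM.
    move=> /(ler_wpM2l (powR_ge0 t s)); move=> /le_trans; apply.
    rewrite mulrCA ler_piMr ?powR_ge0//.
    (* Here [t^s exp (s L(t)) = delta^s], which is at most 1 because [delta <= 1]. *)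
    rewrite /powR gt_eqF// -expRD -mulrDr expR_le1 mulr_ge0_le0 ?(ltW s0)//.
    by rewrite /log_ratio addrC subrK ln_le0.
under eq_integral do rewrite EFinM.
rewrite ge0_integralZl//=; last 2 first.
- exact/measurable_EFinP.
- by rewrite lee_fin powR_ge0.
rewrite EFinM; apply: lee_wpmul2l gK.
by rewrite lee_fin powR_ge0.
Qed.

End log_power_integral.

(** * The function f0 and its grand Lebesgue norm *)

Definition log_power (delta a b : R) : R -> R :=
  (fun t => t `^ (- a) * log_ratio delta t `^ b) \_ `]0, delta[.

Lemma log_power_ge0 (delta a b t : R) : 0 <= log_power delta a b t.
Proof. by rewrite /log_power patchE; case: ifP => // _; rewrite mulr_ge0 ?powR_ge0. Qed.

Lemma measurable_log_power (delta a b : R) :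
  measurable_fun setT (log_power delta a b).
Proof.
apply/(measurable_restrictT _ _).1 => //; apply: measurable_funM.
  by apply: measurable_funTS; exact: measurable_powR.
apply: (measurableT_comp (measurable_powR _)).
by apply: measurable_funTS; apply: measurable_funB => //; exact: measurable_ln.
Qed.

(** The left side is [exp (s ln (1 / s))], and [ln (1 / s) < 1 / s]. *)
Lemma powR_opp_self_le (s : R) : 0 < s -> s `^ (- s) <= expR 1.
Proof.
move=> s0; rewrite /powR gt_eqF// ler_expR mulNr -mulrN -lnV ?posrE//.
rewrite -ler_pdivlMl// mulr1 ltW// ln_sublinear// invr_gt0//.
Qed.

Lemma Lpnorm_log_power_le (delta alpha gamma : R) :
  0 < delta -> delta <= 1 -> 0 < alpha -> 0 < gamma ->
  exists K : R, forall p, p \in `[1, alpha^-1[ ->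
    (Lpnorm p (EFin \o log_power delta alpha (gamma - alpha)) <=
      (K * psi alpha gamma p)%:E)%E.
Proof.
move=> d0 d1 a0 g0; set b := gamma - alpha.
(* The constants must not depend on [p]: [M] bounds [m + 1 = b p + 2] for all [p < 1 / alpha], and
   [1 / gamma] bounds [1 / m]. The maximum with 1 gives [K0^(1/p) <= K0]; the factor
   [alpha^(- gamma)] comes from [s = alpha (1 / alpha - p)]. *)
pose M := `|b| / alpha + 2.
pose K0 := Num.max 1 (M `^ M / gamma).
exists (K0 * expR 1 * alpha `^ (- gamma)) => p; rewrite in_itv/= => /andP[p1 pa].
have p0 : 0 < p by exact: lt_le_trans p1.
pose s := 1 - alpha * p.
have s0 : 0 < s by rewrite subr_gt0 mulrC -ltr_pdivlMr// div1r.
have s1 : s <= 1 by rewrite lerBlDr lerDl mulr_ge0// ltW.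
pose m := b * p + 1.
have mE : m = gamma * p + s by rewrite /m /s /b; ring.
have gm : gamma <= m.
  by rewrite mE (@le_trans _ _ (gamma * p)) ?lerDl ?ler_peMr// ltW.
have m0 : 0 < m by exact: lt_le_trans gm.
have mM : m + 1 <= M.
  rewrite /m /M -addrA lerD2r// (le_trans (ler_norm _))// normrM (gtr0_norm p0).
  by rewrite ler_wpM2l// ltW.
have K1 : 1 <= K0 by rewrite le_max lexx.
have I : (\int[mu]_x ((`|(EFin \o log_power delta alpha b) x| `^ p)%E) <=
    (K0 * s `^ (- m))%:E)%E.
  have -> : (fun x : R => (`|(EFin \o log_power delta alpha b) x| `^ p)%E) =
    (fun t : R => (t `^ (s - 1) * log_ratio delta t `^ (m - 1))%:E) \_ `]0%R, delta[.
    apply/funext => t; rewrite /= (ger0_norm (log_power_ge0 _ _ _ _)).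
    rewrite /log_power !patchE; case: ifP => [tD|_]; last by rewrite powR0// gt_eqF.
    rewrite powRM ?powR_ge0// -!powRrM.
    by congr (_ `^ _ * _ `^ _)%:E; rewrite /s /m; ring.
  rewrite -integral_mkcond; apply: (le_trans (integral_log_power_le d0 d1 s0 m0 mM)).
  rewrite lee_fin mulrCA mulrC ler_wpM2r ?powR_ge0//.
  rewrite le_max; apply/orP; right.
  by rewrite ler_wpM2l ?powR_ge0// lef_pV2 ?posrE.
rewrite /Lpnorm unlock.
apply: (@le_trans _ _ ((K0 * s `^ (- m))%:E `^ p^-1)%E).
  apply: gt0_ler_poweR => //.
  - by rewrite invr_ge0 ltW.
  - by rewrite in_itv/= leey andbT integral_ge0// => x _; exact: poweR_ge0.
  - by rewrite in_itv/= leey andbT lee_fin mulr_ge0 ?powR_ge0// (le_trans _ K1).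
rewrite poweR_EFin lee_fin powRM ?powR_ge0 ?(le_trans _ K1)//.
rewrite -!mulrA; apply: ler_pM; rewrite ?powR_ge0//.
  by apply: ler1_powR => //; rewrite invf_le1.
rewrite -powRrM.
have -> : - m / p = - gamma + - (s / p) by rewrite mE; field; rewrite gt_eqF.
rewrite powRD; last by apply/implyP => _; rewrite gt_eqF.
have -> : s `^ (- gamma) = alpha `^ (- gamma) * psi alpha gamma p.
  rewrite /psi -powRM ?(ltW a0) ?subr_ge0 ?(ltW pa)//.
  by congr (_ `^ _); rewrite /s mulrBr mulfV ?gt_eqF.
rewrite mulrC ler_wpM2r ?mulr_ge0 ?powR_ge0//.
(* As [s <= 1] and [p >= 1], lowering the exponent from [- (s / p)] to [- s] can only increase the
   power. *)
apply: le_trans (powR_opp_self_le s0); apply: ger_powR; first by rewrite s0 s1.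
by rewrite lerN2 ler_pdivrMr// ler_peMr// ltW.
Qed.

Lemma GLspace_log_power (delta alpha gamma : R) :
  0 < delta -> delta <= 1 -> 0 < alpha -> 0 < gamma ->
  GLspace alpha (psi alpha gamma) (log_power delta alpha (gamma - alpha)).
Proof.
move=> d0 d1 a0 g0; split; first exact: measurable_log_power.
have [K hK] := Lpnorm_log_power_le d0 d1 a0 g0.
apply: (@le_lt_trans _ _ K%:E); last exact: ltry.
apply: ge_ereal_sup => _ [p pD <-]; have := hK _ pD.
have psi0 : 0 < psi alpha gamma p.
  by move: pD; rewrite /= in_itv/= => /andP[_ pa]; rewrite powR_gt0// subr_gt0.
by rewrite inver gt_eqF// lee_pdivrMr// EFinM.
Qed.

(** * Lower bounds for the Riesz potential and for norms *)

Lemma log_ratio_expR (delta r : R) : 0 < delta ->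
  log_ratio delta (delta * expR (- r)) = r.
Proof.
by move=> d0; rewrite /log_ratio lnM ?posrE ?expR_gt0// expRK; ring.
Qed.

(** The derivative of [L(x - y)] in [y] is [1 / (x - y)], so [L(x - y)^kappa / kappa] is a
    primitive; [b < delta] keeps [L] positive on the whole interval. *)
Lemma integral_log_ratio_powR (delta kappa x a b : R) : 0 < kappa ->
  0 < a -> a < b -> b < delta ->
  (\int[mu]_(y in `[(x - b)%R, (x - a)%R])
     (log_ratio delta (x - y) `^ (kappa - 1) / (x - y))%:E =
   ((log_ratio delta a `^ kappa - log_ratio delta b `^ kappa) / kappa)%:E)%E.
Proof.
move=> k0 a0 ab bd.
have xy y : y \in `[x - b, x - a] -> 0 < x - y /\ x - y \in `]0, delta[.
  rewrite !in_itv/= => /andP[h1 h2]; have ? : 0 < x - y by lra.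
  by split => //; apply/andP; split => //; lra.
pose F y := log_ratio delta (x - y) `^ kappa / kappa.
have dxy (y : R) : is_derive y (1 : R) (fun y : R => x - y) (- 1).
  by apply: is_derive_eq; rewrite add0r mul1r.
rewrite (@is_derive_FTC2 F); last 3 first.
- by rewrite ltrD2l ltrN2.
- move=> y /xy [z0 /log_ratio_gt0 l0].
  have h1 := @is_derive1_comp _ (log_ratio delta) (fun y : R => x - y) y _ _
    (is_derive_log_ratio delta z0) (dxy y).
  have h2 := @is_derive1_comp _ (@powR R ^~ kappa) _ y _ _ (is_derive1_powR kappa l0) h1.
  apply: (is_derive_eq (is_deriveM h2 (is_derive_cst kappa^-1 y 1))).
  rewrite /= /GRing.scale/= mulr0 add0r mulrNN mulr1.
  by field; rewrite !gt_eqF.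
- move=> y /xy [z0 /log_ratio_gt0 l0].
  have cxy : {for y, continuous (fun y : R => x - y)} := is_derive_continuous (dxy y).
  have cl : {for y, continuous (log_ratio delta \o (fun y : R => x - y))}.
    by apply: continuous_comp; [exact: cxy|exact: continuous_log_ratio].
  apply: continuousM; last by apply: continuousV => //; rewrite gt_eqF.
  apply: (@continuous_comp _ _ _ _ (@powR R ^~ (kappa - 1))); first exact: cl.
  exact: continuous_powRl.
by rewrite /F !opprB !(addrC x) !subrK mulrBl.
Qed.

Lemma truncated_riesz_ge0 (B : set R) (alpha : R) (f : R -> R) (x : R) :
  (forall t, 0 <= f t) -> (0 <= truncated_riesz B alpha f x)%E.
Proof.
by move=> f0; apply: integral_ge0 => y _; rewrite lee_fin divr_ge0 ?powR_ge0.
Qed.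

Lemma truncated_riesz_log_power_ge (B : set R) (delta alpha kappa r x : R) :
  measurable B -> `]- delta, delta[ `<=` B -> 0 < delta -> alpha < 1 ->
  0 < kappa -> 0 < r -> x \in `]0, delta * expR (- r)[ ->
  (((1 - 2^-1 `^ kappa) / kappa * r `^ kappa)%:E <=
    truncated_riesz B alpha (log_power delta alpha (kappa - 1)) x)%E.
Proof.
move=> mB dB d0 a1 k0 r0; rewrite in_itv/= => /andP[x0 xa].
set f := log_power _ _ _.
(* These make [L(a) = r] and [L(b) = r / 2], whence the factor [1 - 2^(- kappa)]. *)
pose a := delta * expR (- r); pose b := delta * expR (- (r / 2)).
have a0 : 0 < a by rewrite mulr_gt0 ?expR_gt0.
have ab : a < b by rewrite ltr_pM2l// ltr_expR ltrN2; lra.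
have bd : b < delta by rewrite gtr_pMr// expR_lt1 oppr_lt0 divr_gt0.
have sub : `[x - b, x - a] `<=` B.
  move=> y /=; rewrite in_itv/= => /andP[h1 h2]; apply: dB.
  rewrite /= in_itv/=; move: xa; rewrite -/a => xa.
  by apply/andP; split; lra.
have mk : measurable_fun setT (fun y : R => f (x - y) / `|y| `^ (1 - alpha)).
  apply: measurable_funM.
    apply: (measurableT_comp (measurable_log_power delta alpha (kappa - 1))).
    exact: measurable_funB.
  under eq_fun do rewrite -powRN.
  by apply: (measurableT_comp (measurable_powR _)).
have k_ge0 y : 0 <= f (x - y) / `|y| `^ (1 - alpha).
  by rewrite divr_ge0 ?powR_ge0 ?log_power_ge0.
apply: (@le_trans _ _ (\int[mu]_(y in `[(x - b)%R, (x - a)%R])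
    (f (x - y) / `|y| `^ (1 - alpha))%:E)%E); last first.
  apply: ge0_subset_integral => //.
  - by apply/measurable_EFinP; exact: measurable_funTS.
  - by move=> y _; rewrite lee_fin.
apply: (@le_trans _ _ (\int[mu]_(y in `[(x - b)%R, (x - a)%R])
    (log_ratio delta (x - y) `^ (kappa - 1) / (x - y))%:E)%E).
  rewrite integral_log_ratio_powR// /a /b !log_ratio_expR// lee_fin.
  rewrite (mulrC r) powRM ?(ltW r0)// le_eqVlt; apply/orP; left.
  by apply/eqP; ring.
have mh : measurable_fun `[x - b, x - a]
    (fun y : R => log_ratio delta (x - y) `^ (kappa - 1) / (x - y)).
  (* [h] is measurable on the whole line, and the power [-1] agrees with the inverse on this
     interval, where [x - y > 0]. *)
  pose h (y : R) := log_ratio delta (x - y) `^ (kappa - 1) * (x - y) `^ (-1).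
  refine (@eq_measurable_fun _ _ _ _ _ h _ _ _).
    move=> y; rewrite inE/= in_itv/= => /andP[h1 h2].
    by rewrite /h powR_inv1//; lra.
  apply/measurable_funTS/measurable_funM.
    apply: (measurableT_comp (measurable_powR _)).
    apply: measurable_funB => //; apply: (measurableT_comp (@measurable_ln R)).
    exact: measurable_funB.
  by apply: (measurableT_comp (measurable_powR _)); exact: measurable_funB.
apply: ge0_le_integral => //=.
- move=> y; rewrite in_itv/= => /andP[h1 h2]; rewrite lee_fin divr_ge0 ?powR_ge0//.
  by lra.
- exact/measurable_EFinP.
- by apply/measurable_EFinP; exact: measurable_funTS.
move=> y; rewrite in_itv/= => /andP[h1 h2]; rewrite lee_fin.
move: xa; rewrite -/a => xa.
have z0 : 0 < x - y by lra.
have y0 : y < 0 by lra.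
have zD : x - y \in `]0, delta[ by rewrite in_itv/= z0/=; lra.
rewrite /f /log_power patchE mem_set// ltr0_norm//.
rewrite mulrC [leRHS]mulrC mulrA ler_wpM2r ?powR_ge0//.
(* Splitting [1 / (x - y)] this way isolates the power contributed by [f]; what remains compares the
   kernel at [- y] and at [x - y], with [0 < - y <= x - y] and [1 - alpha > 0]. *)
have -> : (x - y)^-1 = ((x - y) `^ (1 - alpha))^-1 * (x - y) `^ (- alpha).
  rewrite -powRN -powRD; last by apply/implyP => _; rewrite gt_eqF.
  have -> : - (1 - alpha) + - alpha = -1 by ring.
  by rewrite powR_inv1// ltW.
rewrite ler_wpM2r ?powR_ge0// lef_pV2 ?posrE ?powR_gt0 ?oppr_gt0//.
by apply: ge0_ler_powR; rewrite ?nnegrE; lra.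
Qed.

(** Chebyshev's inequality for the [r]-th power, followed by an [r]-th root. *)
Lemma Lnorm_ge d (T : measurableType d) (nu : {measure set T -> \bar R})
    (A : set T) (c r : R) (u : T -> \bar R) : measurable A -> 0 <= c -> 0 < r ->
  (forall x, A x -> c%:E <= `|u x|)%E ->
  (c%:E * nu A `^ r^-1 <= 'N[nu]_(r%:E)[u])%E.
Proof.
move=> mA c0 r0 cu.
have -> : (c%:E * nu A `^ r^-1 = (((c `^ r)%:E * nu A) `^ r^-1))%E.
  rewrite poweRM ?lee_fin ?powR_ge0// poweR_EFin -powRrM mulfV ?gt_eqF//.
  by rewrite powRr1.
rewrite unlock; apply: gt0_ler_poweR.
- by rewrite invr_ge0 ltW.
- by rewrite in_itv/= leey andbT mule_ge0// lee_fin powR_ge0.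
- by rewrite in_itv/= leey andbT integral_ge0// => x _; exact: poweR_ge0.
apply: le_cst_integral => //; first exact: powR_ge0.
  by move=> x; exact: poweR_ge0.
move=> x /cu cux; rewrite -poweR_EFin; apply: gt0_ler_poweR => //.
- exact: ltW.
- by rewrite in_itv/= leey andbT lee_fin.
- by rewrite in_itv/= leey andbT.
Qed.

End integrals.

(** * Choice of [delta] and of the constants *)

Theorem theorem6 (R : realType) (alpha gamma : R) (B : set R)
    (alpha_gt0 : 0 < alpha) (alpha_lt1 : alpha < 1) (gamma_gt0 : 0 < gamma)
    (domB : origin_domain B) :
  exists2 f0 : R -> R, GLspace alpha (psi alpha gamma) f0 &
  exists2 C2 : R, 0 < C2 &
    forall r : R, 1 <= r ->
      ((C2 * r `^ (1 + gamma - alpha))%:E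
         <= Lpnorm r (truncated_riesz B alpha f0))%E.
Proof.
have [[oB _ _ B0] _] := domB.
have /nbhs_ballP[e /= e0 eB] : nbhs (0 : R) B by apply: open_nbhs_nbhs; split.
(* The cap at 1 serves twice: for the norm bound on f0, and for [delta^(1/r) >= delta] when
   [r >= 1]. *)
pose delta := Num.min e 1.
have d0 : 0 < delta by rewrite lt_min e0 ltr01.
have d1 : delta <= 1 by rewrite ge_min lexx orbT.
have dB : `]- delta, delta[ `<=` B.
  move=> y; rewrite /= in_itv/= -ltr_norml lt_min => /andP[ye _].
  by apply: eB; rewrite /ball/= sub0r normrN.
exists (log_power delta alpha (gamma - alpha)).
  exact: GLspace_log_power.
pose kappa := 1 + gamma - alpha.
have k0 : 0 < kappa by rewrite /kappa; lra.
have kE : gamma - alpha = kappa - 1 by rewrite /kappa; ring.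
pose c := (1 - 2^-1 `^ kappa) / kappa.
have c0 : 0 < c.
  rewrite divr_gt0// subr_gt0.
  have : 2^-1 `^ kappa < 1 `^ kappa.
    by apply: (gt0_ltr_powR k0); rewrite ?nnegrE; lra.
  by rewrite powR1.
(* [c] comes from the pointwise bound on the potential; [delta * expR (- 1)] bounds from below the
   [r]-th root [delta^(1/r) exp (-1)] of the measure [delta exp (- r)]. *)
exists (c * delta * expR (- 1)); first exact: mulr_gt0 (mulr_gt0 c0 d0) (expR_gt0 _).
move=> r r1; have r0 : 0 < r by exact: lt_le_trans r1.
have der0 : 0 < delta * expR (- r) by rewrite mulr_gt0 ?expR_gt0.
rewrite -/kappa kE.
apply: (@le_trans _ _ ((c * r `^ kappa)%:E *
    lebesgue_measure (`]0%R, (delta * expR (- r))%R[ : set R) `^ r^-1)%E); last first.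
  apply: Lnorm_ge => //; first exact: mulr_ge0 (ltW c0) (powR_ge0 _ _).
  move=> x xD; rewrite gee0_abs.
    apply: truncated_riesz_log_power_ge => //; exact: open_measurable.
  by apply: truncated_riesz_ge0; exact: log_power_ge0.
rewrite lebesgue_measure_itv/= lte_fin der0 sube0 poweR_EFin -EFinM lee_fin.
rewrite powRM ?expR_ge0 ?(ltW d0)//.
have -> : expR (- r) `^ r^-1 = expR (- 1).
  by rewrite /powR gt_eqF ?expR_gt0// expRK mulrN mulVf// gt_eqF.
rewrite mulrAC mulrA ler_wpM2r ?expR_ge0//.
rewrite mulrAC ler_wpM2l ?(mulr_ge0 (ltW c0)) ?powR_ge0//.
by apply: ger1_powR; rewrite ?d0 ?d1 ?invf_le1.
Qed.
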